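(* Let $K$ be a (nonempty) metric space, let $A\in\mathcal{D}$, and let $n=i(A)$ (which is finite). Let $k=[\frac{n+1}{2}]$ if $A\cap\partial^nA=\emptyset$, and $k=[\frac n2+1]$ if $A\cap\partial^nA\neq\emptyset$, where $[t]$ is the greatest integer $\le t$. Suppose $W_1,\dots,W_m$ are disjoint DCS's with $A=\bigcup_{i=1}^mW_i$. Then $m\ge k$.
   Context: $\mathcal{D}$ is the algebra of subsets of $K$ generated by the closed (equivalently, open) subsets of $K$. A subset of $K$ is a DCS (difference of closed sets) if it has the form $A_1\setminus A_2$ with $A_1,A_2$ closed in $K$. For $L\subset K$, $\partial_LA$ denotes the boundary of $A\cap L$ relative to the metric subspace $L$. Put $\partial^0A=K$ and $\partial^{n+1}A=\partial_LA$ where $L=\partial^nA$. The index $i(A)$ is the largest $n\ge0$ with $\partial^nA\ne\emptyset$ if there is such an $n$; otherwise $i(A)=\infty$. A set belongs to $\mathcal{D}$ iff its index is finite. *)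

(* Defs.v *)
From HB Require Import structures.
From mathcomp Require Import all_boot all_order all_algebra.
From mathcomp Require Import boolp classical_sets reals constructive_ereal.
From mathcomp Require Import topology measurable_structure.

Set Implicit Arguments.
Unset Strict Implicit.
Unset Printing Implicit Defensive.

Local Open Scope classical_set_scope.

Definition set_algebra {T : Type} (G : set (set T)) : Prop :=
  [/\ G set0, setC_closed G & setU_closed G].

Definition boundary {T : topologicalType} (A : set T) : set T :=
  closure A `\` interior A.

Section Index.
Context {K : topologicalType}.
Implicit Types (A L : set K) (n : nat).

Definition closed_algebra : set (set K) := smallest set_algebra closed.

Definition dcs (W : set K) : Prop :=
  exists A1 A2, [/\ closed A1, closed A2 & W = A1 `\` A2].

(* [subspace L] has the same carrier as K: it induces the relative topology on
   L and makes every point outside L isolated.  Such a point is never a boundary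
   point, so this set is contained in L and is the boundary relative to L. *)
Definition rel_boundary L A : set K :=
  boundary (A `&` L : set (subspace L)).

Fixpoint iter_boundary A n : set K :=
  if n is n'.+1 then rel_boundary (iter_boundary A n') A else setT.

Definition is_max_level A n : Prop :=
  iter_boundary A n !=set0 /\
  forall p, iter_boundary A p !=set0 -> (p <= n)%N.

Definition boundary_index A : \bar nat :=
  if pselect (exists n, is_max_level A n) is left h
  then (projT1 (cid h))%:E else +oo%E.

End Index.

(* Main.v *)
(** Finiteness of the index: call a bounded upper semicontinuous function
    [r : K -> nat] adapted to [A] if near every [x] the points [y] with
    [r y = r x] lie on the same side of [A] as [x].  Indicators of closed sets
    are adapted to them and sums of adapted functions are adapted to unions, so
    every set of the algebra has an adapted function [r]; by induction on [n],
    [r >= n] on the [n]-th iterated boundary, which is thus empty for large [n].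

    Lower bound: a point [x] of the [n]-th iterated boundary has, arbitrarily
    near, a point of the previous one on the other side of [A], and so on.  If
    [x] lies in the piece [F `\` G], the next point [y] avoids [A] and, being
    near [x], avoids [G]; hence it avoids the closed set [F], and all later points of
    the chain avoid this piece as well.  So the members of the chain that
    lie in [A] belong to distinct pieces. *)
Require Import Defs.
From mathcomp Require Import all_boot all_order all_algebra.
From mathcomp Require Import boolp classical_sets reals constructive_ereal.
From mathcomp Require Import topology.
From mathcomp Require Import finmap zify.

Local Open Scope classical_set_scope.

Section IteratedBoundary.
Context {K : topologicalType}.
Implicit Types (A B L : set K) (x y : K) (n : nat).

Lemma nbhs_subspace_at L x (U : set K) : L x ->
  nbhs (x : subspace L) U = within L (nbhs x) U.
Proof. by case: (@nbhs_subspaceP _ L x). Qed.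

Lemma rel_boundaryP {L A x} : rel_boundary L A x <->
  [/\ L x, forall U, nbhs x U -> exists y, [/\ U y, L y & A y]
         & forall U, nbhs x U -> exists y, [/\ U y, L y & ~ A y]].
Proof.
rewrite /rel_boundary /boundary; split.
- case=> clx nint.
  have Lx : L x.
    apply: contrapT => nLx.
    have /clx [y [[_ Ly] yx]] : nbhs (x : subspace L) [set x].
      by case: (@nbhs_subspaceP _ L x) => // _ _ ->.
    by rewrite yx in Ly.
  split=> // U xU.
    have /clx [y [[Ay Ly] Uy]] : nbhs (x : subspace L) U.
      rewrite nbhs_subspace_at //.
      by apply: filterS xU => y Uy _.
    by exists y.
  apply: contrapT => noy; apply: nint.
  rewrite /interior /= nbhs_subspace_at //.
  apply: filterS xU => y Uy Ly; split=> //.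
  by apply: contrapT => nAy; apply: noy; exists y.
- case=> Lx meetA meetC; split.
    move=> U; rewrite nbhs_subspace_at // => xU.
    by have [y [Uy Ly Ay]] := meetA _ xU; exists y; do 2?split=> //; apply: Uy.
  rewrite /interior /= nbhs_subspace_at // => /meetC [y [ALy Ly nAy]].
  by case: (ALy Ly).
Qed.

(** As [r] has integer values, the inequality near [x] is upper semicontinuity. *)
Definition adapted A (r : K -> nat) : Prop :=
  forall x, \forall y \near x, (r y <= r x)%N /\ (r y = r x -> (A y <-> A x)).

Definition bounded_adapted A : Prop :=
  exists r N, adapted A r /\ forall x, (r x <= N)%N.

Lemma bounded_adapted_closed A : closed A -> bounded_adapted A.
Proof.
move=> cA; exists (fun x => `[< A x >] : nat), 1; split; last first.
  by move=> x; case: asboolP.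
move=> x; case: (asboolP (A x)) => Ax.
  by apply: filterE => y; case: asboolP.
have : nbhs x (~` A) by apply: open_nbhs_nbhs; split=> //; exact: closed_openC.
by apply: filterS => y nAy; rewrite asboolF.
Qed.

Lemma bounded_adapted_algebra : set_algebra bounded_adapted.
Proof.
split.
- exact/bounded_adapted_closed/closed0.
- move=> A [r [N [rA rN]]]; exists r, N; split=> // x.
  by apply: filterS (rA x) => y [le eqA]; split=> // /eqA AE; split; apply: contra_not; apply AE.
- move=> A B [r [N [rA rN]]] [s [M [sB sM]]].
  exists (fun x => r x + s x), (N + M); split; last by move=> x; exact: leq_add.
  move=> x; apply: filterS2 (rA x) (sB x) => y [ler eqA] [les eqB]; split.
    exact: leq_add.
  (* Neither summand increases near [x], so equal sums force equal summands. *)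
  move=> e; have {}/eqA eqA : r y = r x by lia.
  have {}/eqB eqB : s y = s x by lia.
  by rewrite /setU /=; tauto.
Qed.

(** If [r x = n] at a point of the next boundary, then by induction [r = n] at all nearby points of
    the [n]-th one, so these lie on one side of [A]: a contradiction. *)
Lemma adapted_iter_boundary {A r n x} :
  adapted A r -> iter_boundary A n x -> (n <= r x)%N.
Proof.
move=> rA; elim: n x => // n IH x /rel_boundaryP[Dx meetA meetC].
rewrite ltn_neqAle IH // andbT; apply/eqP => rx.
have same y : (r y <= r x)%N /\ (r y = r x -> (A y <-> A x)) ->
    iter_boundary A n y -> A y <-> A x.
  by move=> [le eqA] Dy; apply: eqA; have := IH _ Dy; lia.
have [y [/same yx Dy Ay]] := meetA _ (rA x).
have [z [/same zx Dz nAz]] := meetC _ (rA x).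
by apply: nAz; apply/(zx Dz)/(yx Dy).
Qed.

Lemma boundary_indexE {A n} : is_max_level A n -> boundary_index A = n%:E.
Proof.
move=> [Dn maxn]; rewrite /boundary_index; case: pselect => [h|]; last first.
  by case; exists n.
case: (cid h) => p [Dp maxp] /=; congr EFin; apply/eqP.
by rewrite eqn_leq maxn //= maxp.
Qed.

Lemma closed_algebra_max_level {A} : [set: K] !=set0 -> closed_algebra A ->
  exists n, is_max_level A n.
Proof.
move=> K0 DA.
have [r [N [rA rN]]] : bounded_adapted A.
  apply: DA; split; first exact: bounded_adapted_algebra.
  exact: bounded_adapted_closed.
have D0 : exists n, `[< iter_boundary A n !=set0 >] by exists 0; exact/asboolP.
have DN n : `[< iter_boundary A n !=set0 >] -> (n <= N)%N.
  by move/asboolP=> [x /(adapted_iter_boundary rA) nr]; exact: leq_trans (rN x).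
case: (ex_maxnP D0 DN) => n /asboolP Dn maxn; exists n; split=> // p Dp.
exact/maxn/asboolP.
Qed.

(* [J] collects the pieces already used by the chain: their closed parts [F j]
   avoid the current point [x]. *)
Lemma iter_boundary_pieces {A m} {F G : 'I_m -> set K} :
  (forall i, closed (F i)) -> (forall i, closed (G i)) ->
  A = \bigcup_i (F i `\` G i) ->
  forall n x (J : {set 'I_m}), iter_boundary A n x ->
    (forall j, j \in J -> ~ F j x) ->
  ((if `[< A x >] then n./2.+1 else n.+1./2) + #|J| <= m)%N.
Proof.
move=> cF cG AE; elim=> [|n IH] x J.
  move=> _ JF; case: asboolP => Ax; last first.
    by rewrite -[m in leqRHS]card_ord; exact: max_card.
  have [i _ [Fi _]] : (\bigcup_i (F i `\` G i)) x by rewrite -AE.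
  (* The piece through [x] is new, so [J] has at most [m - 1] elements. *)
  have iJ : i \notin J by apply/negP => /JF.
  by rewrite -[m in leqRHS]card_ord; have := max_card (mem (i |: J)); rewrite cardsU1 iJ.
move=> /rel_boundaryP[Dx meetA meetC] JF.
have nF : nbhs x (\bigcap_(j in [set` [fset j | j in J]%fset]) ~` F j).
  apply: filter_bigI => j; rewrite finmap.inE => jJ.
  by apply: open_nbhs_nbhs; split; [exact: closed_openC|exact: JF].
have avoidF y : (\bigcap_(j in [set` [fset j | j in J]%fset]) ~` F j) y ->
    forall j, j \in J -> ~ F j y.
  by move=> Fy j jJ; apply: Fy; rewrite /= finmap.inE.
case: asboolP => Ax.
- have [i _ [Fi nGi]] : (\bigcup_i (F i `\` G i)) x by rewrite -AE.
  have iJ : i \notin J by apply/negP => /JF.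
  have nG : nbhs x (~` G i).
    by apply: open_nbhs_nbhs; split=> //; exact: closed_openC.
  have [y [[Fy Gy] Dy nAy]] := meetC _ (filterI nF nG).
  have JFy j : j \in i |: J -> ~ F j y.
    rewrite in_setU1 => /predU1P[->|]; last exact: avoidF Fy _.
    move=> Fiy.
    by apply: nAy; rewrite AE; exists i.
  (* The unit lost in passing to a point outside [A] is regained as [i] joins [J]. *)
  have := IH y _ Dy JFy.
  by rewrite asboolF // cardsU1 iJ addnA addn1.
(* Entering [A] uses up no piece: [J] is kept, and [n.+2./2] computes to [n./2.+1]. *)
- have [y [Fy Dy Ay]] := meetA _ nF.
  by have := IH y J Dy (avoidF _ Fy); rewrite asboolT.
Qed.

End IteratedBoundary.

Theorem corollary2p3 (R : realType) (K : metricType R)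
    (K0 : [set: K] !=set0) (A : set K) (DA : closed_algebra A) :
  exists2 n : nat, boundary_index A = n%:E &
    let k := if `[< A `&` iter_boundary A n = set0 >]
             then ((n + 1) %/ 2)%N else (n %/ 2 + 1)%N in
    forall (m : nat) (W : 'I_m -> set K),
      (forall i, dcs (W i)) ->
      trivIset [set: 'I_m] W ->
      A = \bigcup_i W i ->
      (k <= m)%N.
Proof.
have [n maxn] := closed_algebra_max_level K0 DA.
exists n; first exact: boundary_indexE.
move=> /= m W dcsW _ AE.
have [F FP] := choice dcsW; have [G FG] := choice FP.
have {AE} AE : A = \bigcup_i (F i `\` G i).
  by rewrite AE; apply: eq_bigcupr => i _; have [] := FG i.
have cF i : closed (F i) by have [] := FG i.
have cG i : closed (G i) by have [] := FG i.
(* The chain starts in the last nonempty boundary, with no piece used yet. *)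
have bound x := iter_boundary_pieces cF cG AE n x finset.set0.
rewrite addn1 !divn2 addn1; case: asboolP => [AD0|/eqP/set0P[x [Ax Dx]]].
- have [x Dx] := maxn.1.
  have nAx : ~ A x by move=> Ax; rewrite -[False]/(set0 x) -AD0.
  have := bound x Dx; rewrite asboolF // cards0 addn0; apply=> j.
  by rewrite finset.inE.
- have := bound x Dx; rewrite asboolT // cards0 addn0; apply=> j.
  by rewrite finset.inE.
Qed.
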